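(* Suppose the data satisfy Assumptions (A1) and (A2) stated in the context. Let $\lambda\in[\lambda_1,\lambda_2)$ and $\epsilon>0$ be such that (i) there exist $t_0>0$ and $m\in\mathcal{M}$ with $M^m_{t_0}[0]\ge \epsilon I$, and (ii) $M_t^m[P_0]\in[\epsilon I,\lambda I]$ for all $m\in\mathcal{M}$, $t\ge 0$ and $P_0\in[\epsilon I,\lambda I]$ (in particular these Riccati solutions exist for all $t\geq 0$). Then there exist $\alpha>0$ and $K>0$ such that $$V(x)-S_T[V^0](x)\le K e^{-\alpha T}|x|^2\qquad \text{for all } x\in\mathbb{R}^n,$$ for all $T>0$ and all functions $V^0(x)=\frac12 x'P_0x$ with $P_0\in[\epsilon I,\lambda I]$.
   Context: Data: a finite set $\mathcal{M}=\{1,\dots,M\}$, a real $\gamma>0$, and for each $m\in\mathcal{M}$ matrices $A^m\in\mathbb{R}^{n\times n}$, $\sigma^m\in\mathbb{R}^{n\times k}$ and symmetric $D^m\in\mathbb{R}^{n\times n}$. Put $\Sigma^m:=\frac{1}{\gamma^2}\sigma^m(\sigma^m)'$ (prime denotes transpose). Assumption (A1): there are constants $c_A,c_\sigma,c_D>0$ such that for all $m\in\mathcal{M}$ and $x\in\mathbb{R}^n$: $x'A^mx\le -c_A|x|^2$; $|\sigma^m|\le c_\sigma$ (operator norm); $D^m$ is positive definite with $x'D^mx\le c_D|x|^2$; and $c_A^2>c_Dc_\sigma^2/\gamma^2$. Assumption (A2): there is $m_D>0$ with $x'D^mx\ge m_D|x|^2$ for all $x\in\mathbb{R}^n$, $m\in\mathcal{M}$,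 and $\frac{c_\sigma^2}{\gamma^2}m_D>\big(c_A-\sqrt{c_A^2-c_Dc_\sigma^2/\gamma^2}\big)^2$. Fix such constants and set $\lambda_1=\frac{\gamma^2\left(c_A-\sqrt{c_A^2-c_Dc_\sigma^2/\gamma^2}\right)}{c_\sigma^2}$, $\lambda_2=\sqrt{m_D\gamma^2/c_\sigma^2}$. Control problem: $\mathcal{W}$ is the set of measurable $w:[0,\infty)\to\mathbb{R}^k$ with $\int_0^T|w_t|^2dt<\infty$ for all $T<\infty$; $\mathcal{D}_\infty$ (resp. $\mathcal{D}_T$) is the set of measurable $\mu:[0,\infty)\to\mathcal{M}$ (resp. $\mu:[0,T)\to\mathcal{M}$). Given $x,w,\mu$, the trajectory $\xi$ solves $\dot\xi_t=A^{\mu_t}\xi_t+\sigma^{\mu_t}w_t$, $\xi_0=x$. The value function is $$V(x)=\sup_{w\in\mathcal{W}}\sup_{\mu\in\mathcal{D}_\infty}\sup_{T>0}\int_0^T\tfrac12\xi_t'D^{\mu_t}\xi_t-\tfrac{\gamma^2}{2}|w_t|^2\,dt,$$ and the semigroup is $S_T[V^0](x)=\sup_{w\in\mathcal{W}}\sup_{\mu\in\mathcal{D}_T}\left(\int_0^T\tfrac12\xi_t'D^{\mu_t}\xi_t-\tfrac{\gamma^2}{2}|w_t|^2\,dt+V^0(\xi_T)\right)$. Riccati flows: $\Phi_m(P)=(A^m)'P+PA^m+P\Sigma^mP+D^m$ on symmetric $n\times n$ matrices; $M^m_t[P_0]=P(t)$, where $P(\cdot)$ is the maximal solution of $\dot P=\Phi_m(P)$,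 $P(0)=P_0$. The order $\le$ on symmetric matrices is the Loewner order and $[A,B]=\{P \text{ symmetric}: A\le P\le B\}$. *)

(* Defs.v *)
From HB Require Import structures.
From mathcomp Require Import all_boot all_order all_algebra.
From mathcomp Require Import all_classical all_reals all_analysis.
Import Order.TTheory GRing.Theory Num.Theory.
Import numFieldNormedType.Exports.

Set Implicit Arguments.
Unset Strict Implicit.
Unset Printing Implicit Defensive.

Local Open Scope classical_set_scope.
Local Open Scope ring_scope.

(* Symmetry of the D^m and positivity of gamma are hypotheses of the theorem.
   Modes are elements of 'I_M. *)
Record system (R : realType) (M n k : nat) := System {
  drift : 'I_M -> 'M[R]_n;            (* A^m *)
  diffusion : 'I_M -> 'M[R]_(n, k);   (* sigma^m *)
  cost : 'I_M -> 'M[R]_n;             (* D^m *)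
  gain : R                            (* gamma *)
}.

(* The library norm `|x| on matrices is the sup norm, hence this definition. *)
Definition enorm (R : realType) (n : nat) (x : 'cV[R]_n) : R :=
  Num.sqrt (\sum_i x i 0 ^+ 2).

Definition opnorm (R : realType) (n k : nat) (B : 'M[R]_(n, k)) : R :=
  sup [set enorm (B *m w) | w in [set w : 'cV[R]_k | enorm w <= 1]].

Definition qform (R : realType) (n : nat) (P : 'M[R]_n) (x : 'cV[R]_n) : R :=
  (x^T *m P *m x) 0 0.

Definition loewner_le (R : realType) (n : nat) (P Q : 'M[R]_n) : Prop :=
  forall x : 'cV[R]_n, 0 <= qform (Q - P) x.

Definition loewner_itv (R : realType) (n : nat) (A B : 'M[R]_n)
  : set 'M[R]_n :=
  [set P | [/\ P^T = P, loewner_le A P & loewner_le P B]].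

Definition assumptionA1 (R : realType) (M n k : nat) (S : system R M n k)
    (cA cs cD : R) : Prop :=
  [/\ [/\ 0 < cA, 0 < cs & 0 < cD],
      forall m (x : 'cV[R]_n), qform (drift S m) x <= - cA * enorm x ^+ 2,
      forall m, opnorm (diffusion S m) <= cs,
      forall m (x : 'cV[R]_n),
        (x != 0 -> 0 < qform (cost S m) x) /\
        qform (cost S m) x <= cD * enorm x ^+ 2
    & cD * cs ^+ 2 / gain S ^+ 2 < cA ^+ 2].

Definition assumptionA2 (R : realType) (M n k : nat) (S : system R M n k)
    (cA cs cD mD : R) : Prop :=
  [/\ 0 < mD,
      forall m (x : 'cV[R]_n), mD * enorm x ^+ 2 <= qform (cost S m) x
    & (cA - Num.sqrt (cA ^+ 2 - cD * cs ^+ 2 / gain S ^+ 2)) ^+ 2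
        < cs ^+ 2 / gain S ^+ 2 * mD].

Definition lambda1 (R : realType) (gamma cA cs cD : R) : R :=
  gamma ^+ 2 * (cA - Num.sqrt (cA ^+ 2 - cD * cs ^+ 2 / gamma ^+ 2))
    / cs ^+ 2.

Definition lambda2 (R : realType) (gamma cs mD : R) : R :=
  Num.sqrt (mD * gamma ^+ 2 / cs ^+ 2).

Section Control.
Context {R : realType} {M n k : nat}.
Variable S : system R M n k.
Local Notation leb := (@lebesgue_measure R).

(* The class W; only the values on [0, +oo[ matter. Measurable means Borel here
   and in switching: a Lebesgue measurable control is a.e. equal to a Borel one,
   with the same trajectory and payoff. *)
Definition disturbance (w : R -> 'cV[R]_k) : Prop :=
  (forall j, measurable_fun (`[0, +oo[ : set R) (fun t => w t j 0)) /\
  (forall T : R, (\int[leb]_(t in `[0%R, T]) (enorm (w t) ^+ 2)%:E < +oo)%E).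

(* Measurability on E for the discrete sigma-algebra on 'I_M:
   E = [0, +oo[ gives D_oo and E = [0, T[ gives D_T. *)
Definition switching (E : set R) (mu : R -> 'I_M) : Prop :=
  forall Y : set 'I_M, measurable (E `&` mu @^-1` Y).

(* Solutions on E (an interval starting at 0) in the sense of Caratheodory:
   xi is continuous and satisfies the integrated equation coordinatewise. *)
Definition trajectory (E : set R) (w : R -> 'cV[R]_k) (mu : R -> 'I_M)
    (x : 'cV[R]_n) (xi : R -> 'cV[R]_n) : Prop :=
  {within E, continuous xi} /\
  forall t i, E t ->
    xi t i 0 = x i 0 +
      \int[leb]_(s in `[0, t])
         (drift S (mu s) *m xi s + diffusion S (mu s) *m w s) i 0.

Definition payoff (T : R) (w : R -> 'cV[R]_k) (mu : R -> 'I_M)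
    (xi : R -> 'cV[R]_n) : \bar R :=
  (\int[leb]_(t in `[0%R, T])
     (2^-1 * qform (cost S (mu t)) (xi t)
       - gain S ^+ 2 / 2 * enorm (w t) ^+ 2)%:E)%E.

Definition value (x : 'cV[R]_n) : \bar R :=
  ereal_sup [set v | exists w mu xi (T : R),
    [/\ disturbance w, switching `[0, +oo[ mu,
        trajectory `[0, +oo[ w mu x xi, 0 < T & v = payoff T w mu xi]].

(* mu is constrained on [0, T[ only; mu T enters only through integrals over
   the null set {T}. *)
Definition semigroup (T : R) (V0 : 'cV[R]_n -> R) (x : 'cV[R]_n) : \bar R :=
  ereal_sup [set v | exists w mu xi,
    [/\ disturbance w, switching `[0, T[ mu, trajectory `[0, T] w mu x xi
      & v = (payoff T w mu xi + (V0 (xi T))%:E)%E]].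

Definition Sigma (m : 'I_M) : 'M[R]_n :=
  (gain S ^+ 2)^-1 *: (diffusion S m *m (diffusion S m)^T).

Definition riccati (m : 'I_M) (P : 'M[R]_n) : 'M[R]_n :=
  (drift S m)^T *m P + P *m drift S m + P *m Sigma m *m P + cost S m.

(* Solutions on [0, b[. The derivative is required on ]0, b[; with continuity
   on [0, b[ this also gives the right derivative at 0. *)
Definition riccati_solution (m : 'I_M) (P0 : 'M[R]_n) (b : \bar R)
    (P : R -> 'M[R]_n) : Prop :=
  [/\ P 0 = P0,
      {within [set t : R | 0 <= t /\ (t%:E < b)%E], continuous P},
      forall t : R, 0 <= t -> (t%:E < b)%E -> (P t)^T = P t
    & forall t : R, 0 < t -> (t%:E < b)%E ->
        is_derive t (1 : R) P (riccati m (P t))].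

Definition riccati_maximal (m : 'I_M) (P0 : 'M[R]_n) (b : \bar R)
    (P : R -> 'M[R]_n) : Prop :=
  [/\ (0 < b)%E, riccati_solution m P0 b P
    & forall b' P', riccati_solution m P0 b' P' ->
        (forall t : R, 0 <= t -> (t%:E < b)%E -> P' t = P t) -> (b' <= b)%E].

(* M^m_t[P0] is defined and equal to Q. *)
Definition riccati_flow (m : 'I_M) (t : R) (P0 Q : 'M[R]_n) : Prop :=
  exists b P, [/\ riccati_maximal m P0 b P, 0 <= t, (t%:E < b)%E & P t = Q].

End Control.

(* Main.v *)
Require Import Defs.
From HB Require Import structures.
From mathcomp Require Import all_boot all_order all_algebra.
From mathcomp Require Import all_classical all_reals all_analysis.
From mathcomp Require Import measurable_realfun ring lra.
Import Order.TTheory GRing.Theory Num.Theory.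
Import numFieldNormedType.Exports.

Set Implicit Arguments.
Unset Strict Implicit.
Unset Printing Implicit Defensive.

Local Open Scope classical_set_scope.
Local Open Scope ring_scope.

(* With q(l) = l^2 cs^2/gamma^2 - 2 cA l + cD, every trajectory satisfies
   d/dt (l/2 |xi|^2) + running payoff <= q(l)/2 |xi|^2.  Since q(lambda_1) = 0,
   this gives V <= lambda_1/2 |x|^2.  At the vertex L > lambda_1 of the parabola,
   q(L) < 0.  Along a d-optimal trajectory the payoff collected on [t, T] is at
   least -d - lambda_1/2 |xi_T|^2, so the inequality for L yields
     (L - lambda_1)/2 |xi_T|^2 - q(L)/2 int_t^T |xi|^2 <= L/2 |xi_t|^2 + d
   for all t, and Gronwall backwards in time makes |xi_T|^2 exponentially small,
   up to d.  Truncating such a trajectory at T loses at most lambda_1/2 |xi_T|^2;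
   one that stops before T is continued with zero disturbance, which only adds
   nonnegative payoff. *)

(** * Euclidean norm, quadratic forms and Young's inequality *)

Lemma sqr_enorm (R : realType) (n : nat) (x : 'cV[R]_n) :
  enorm x ^+ 2 = \sum_i x i 0 ^+ 2.
Proof. by rewrite /enorm sqr_sqrtr// sumr_ge0// => i _; rewrite sqr_ge0. Qed.

Lemma enorm_ge0 (R : realType) (n : nat) (x : 'cV[R]_n) : 0 <= enorm x.
Proof. exact: sqrtr_ge0. Qed.

Lemma enorm0 (R : realType) (n : nat) : enorm (0 : 'cV[R]_n) = 0.
Proof.
by apply/eqP; rewrite -sqrf_eq0 sqr_enorm big1// => i _; rewrite mxE expr0n.
Qed.

Lemma enormZ (R : realType) (n : nat) (a : R) (x : 'cV[R]_n) :
  enorm (a *: x) = `|a| * enorm x.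
Proof.
apply/eqP; rewrite -(@eqrXn2 _ 2) ?mulr_ge0 ?enorm_ge0//; apply/eqP.
rewrite exprMn real_normK ?num_real// !sqr_enorm mulr_sumr.
by apply: eq_bigr => i _; rewrite mxE exprMn.
Qed.

Lemma coord_le_enorm (R : realType) (n : nat) (x : 'cV[R]_n) i :
  `|x i 0| <= enorm x.
Proof.
rewrite -(@ler_pXn2r _ 2) ?nnegrE ?enorm_ge0// real_normK ?num_real//.
by rewrite sqr_enorm (bigD1 i)//= lerDl sumr_ge0// => j _; rewrite sqr_ge0.
Qed.

Lemma qformE (R : realType) (n : nat) (A : 'M[R]_n) (x : 'cV[R]_n) :
  qform A x = \sum_i x i 0 * (A *m x) i 0.
Proof. by rewrite /qform -mulmxA mxE; apply: eq_bigr => i _; rewrite mxE. Qed.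

Lemma qform_scalar (R : realType) (n : nat) (a : R) (x : 'cV[R]_n) :
  qform a%:M x = a * enorm x ^+ 2.
Proof.
rewrite qformE sqr_enorm mulr_sumr mul_scalar_mx.
by apply: eq_bigr => i _; rewrite mxE; ring.
Qed.

Lemma qformB (R : realType) (n : nat) (A B : 'M[R]_n) (x : 'cV[R]_n) :
  qform (A - B) x = qform A x - qform B x.
Proof. by rewrite /qform mulmxBr mulmxBl !mxE. Qed.

Lemma enorm_mulmx_le (R : realType) (n k : nat) (B : 'M[R]_(n, k))
    (w : 'cV[R]_k) :
  enorm (B *m w) <= opnorm B * enorm w.
Proof.
have bnd v : enorm v <= 1 -> enorm (B *m v) <= opnorm B.
  move=> v1; apply: ub_le_sup; last by exists v.
  (* A real [sup] is an upper bound only of a bounded set. On the unit ball every coordinate is at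
     most 1 in absolute value, so row [i] contributes at most its absolute sum. *)
  exists (Num.sqrt (\sum_i (\sum_j `|B i j|) ^+ 2)) => _ [u /= u1 <-].
  rewrite ler_wsqrtr// ler_sum// => i _.
  rewrite -[leLHS]real_normK ?num_real// lerXn2r ?nnegrE ?sumr_ge0//.
  rewrite mxE (le_trans (ler_norm_sum _ _ _))// ler_sum// => j _.
  by rewrite normrM ler_piMr// (le_trans (coord_le_enorm _ _)).
have [w0|w0] := eqVneq (enorm w) 0.
  suff -> : w = 0 by rewrite mulmx0 !enorm0 mulr0.
  apply/colP => i; rewrite mxE; apply/eqP; rewrite -normr_le0 -w0.
  exact: coord_le_enorm.
have wp : 0 < enorm w by rewrite lt_neqAle eq_sym w0 enorm_ge0.
have := bnd ((enorm w)^-1 *: w).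
rewrite -scalemxAr !enormZ normfV (ger0_norm (enorm_ge0 _)) mulVf// => /(_ (lexx _)).
by rewrite mulrC ler_pdivrMr.
Qed.

(** In each coordinate the two sides differ by [(s * a - b) ^+ 2 / (2 * s)]. *)
Lemma young_dot (R : realType) (n : nat) (s : R) (x y : 'cV[R]_n) : 0 < s ->
  \sum_i x i 0 * y i 0 <= s / 2 * enorm x ^+ 2 + s^-1 / 2 * enorm y ^+ 2.
Proof.
move=> s0; rewrite !sqr_enorm !mulr_sumr -big_split/= ler_sum// => i _.
move: (x i 0) (y i 0) => a b; rewrite -subr_ge0.
have -> : s / 2 * a ^+ 2 + s^-1 / 2 * b ^+ 2 - a * b = (s * a - b) ^+ 2 / (2 * s).
  by field; rewrite gt_eqF.
by rewrite divr_ge0 ?sqr_ge0// mulr_ge0// ltW.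
Qed.

(** * Pointwise dissipation inequality *)

Section RunningPayoff.
Context {R : realType} {M n k : nat}.
Variable S : system R M n k.

Definition running (w : R -> 'cV[R]_k) (mu : R -> 'I_M) (xi : R -> 'cV[R]_n)
    (t : R) : R :=
  2^-1 * qform (cost S (mu t)) (xi t) - gain S ^+ 2 / 2 * enorm (w t) ^+ 2.

Definition velocity (w : R -> 'cV[R]_k) (mu : R -> 'I_M) (xi : R -> 'cV[R]_n)
    (t : R) : 'cV[R]_n :=
  drift S (mu t) *m xi t + diffusion S (mu t) *m w t.

(** The polynomial q of the opening comment. Under (A1) and for [l >= 0], the form of
    [riccati S m l%:M] at [x] is at most this value times |x|^2. *)
Definition residual (cA cs cD l : R) : R :=
  l ^+ 2 * (cs ^+ 2 / gain S ^+ 2) - 2 * cA * l + cD.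

(** (A1) bounds drift and cost directly; Young's inequality splits the cross term so that the
    penalty in [running] pays exactly for its part in [w]. *)
Lemma running_velocity_le (cA cs cD l : R) (w : R -> 'cV[R]_k)
    (mu : R -> 'I_M) (xi : R -> 'cV[R]_n) (t : R) :
    0 < gain S -> assumptionA1 S cA cs cD -> 0 < l ->
  l * (\sum_i xi t i 0 * velocity w mu xi t i 0) + running w mu xi t
    <= residual cA cs cD l / 2 * enorm (xi t) ^+ 2.
Proof.
move=> g0 [[cA0 cs0 cD0] hA hs hD _] l0.
rewrite /velocity /running; move: (mu t) (xi t) (w t) => m x v.
have -> : \sum_i x i 0 * (drift S m *m x + diffusion S m *m v) i 0 =
    qform (drift S m) x + \sum_i x i 0 * (diffusion S m *m v) i 0.
  by rewrite qformE -big_split/=; apply: eq_bigr => i _; rewrite mxE mulrDr.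
(* With this weight [l * (s^-1 / 2) * cs ^+ 2 = gain S ^+ 2 / 2], and the part in [x] becomes the
   quadratic term of [residual]. *)
set s := l * cs ^+ 2 / gain S ^+ 2.
have s0 : 0 < s by rewrite /s !pmulr_rgt0// ?invr_gt0 ?exprn_gt0.
have := @young_dot _ _ s x (diffusion S m *m v) s0.
have : enorm (diffusion S m *m v) ^+ 2 <= cs ^+ 2 * enorm v ^+ 2.
  rewrite -exprMn lerXn2r ?nnegrE ?mulr_ge0 ?enorm_ge0 ?(ltW cs0)//.
  by rewrite (le_trans (enorm_mulmx_le _ _))// ler_wpM2r ?enorm_ge0.
have [_] := hD m x; have := hA m x.
move: (qform (drift S m) x) (qform (cost S m) x) (enorm x ^+ 2) => a d X.
move: (enorm v ^+ 2) (enorm (_ *m v) ^+ 2) (\sum_i _) => W Z e.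
move=> ha hd hZ he.
have : l * e <= l * (s / 2 * X + s^-1 / 2 * (cs ^+ 2 * W)).
  rewrite ler_pM2l//; apply: le_trans he _; rewrite lerD2l ler_wpM2l//.
  by rewrite divr_ge0// invr_ge0 ltW.
have -> : l * (s / 2 * X + s^-1 / 2 * (cs ^+ 2 * W)) =
    l ^+ 2 * (cs ^+ 2 / gain S ^+ 2) / 2 * X + gain S ^+ 2 / 2 * W.
  by rewrite /s; field; rewrite !gt_eqF.
have : l * a <= l * (- cA * X) by rewrite ler_pM2l.
by rewrite /residual; lra.
Qed.

End RunningPayoff.

(** * Increment bounds from local ones, and finite sums of limits *)

(** A continuation argument: the set [A] of times at which the bound holds contains its supremum
    [c], and the local bound at [c] would carry it further if [c < b]. *)
Lemma straddle_bound (R : realType) (phi G : R -> R) (e a b : R) :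
    a <= b -> 0 <= e -> {in `[a, b] &, {homo G : s t / s <= t}} ->
    (forall c, a <= c <= b -> exists2 d, 0 < d &
      forall t, a <= t <= b -> `|t - c| < d ->
        `|phi t - phi c| <= e * `|G t - G c|) ->
  `|phi b - phi a| <= e * (G b - G a).
Proof.
move=> ab e0 mG loc.
pose A := [set t | a <= t <= b /\ `|phi t - phi a| <= e * (G t - G a)].
have step s t : a <= s -> s <= t -> t <= b -> A s ->
    `|phi t - phi s| <= e * `|G t - G s| -> A t.
  move=> as_ st tb [_ As] h; split; first by rewrite tb (le_trans as_ st).
  have := mG s t; rewrite !in_itv/= as_ tb (le_trans as_ st) (le_trans st tb).
  move=> /(_ isT isT st) Gst.
  rewrite (ger0_norm (_ : 0 <= G t - G s)) ?subr_ge0// in h.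
  have -> : phi t - phi a = (phi t - phi s) + (phi s - phi a) by ring.
  apply: le_trans (ler_normD _ _) _.
  have -> : e * (G t - G a) = e * (G t - G s) + e * (G s - G a) by ring.
  exact: lerD.
have Aa : A a by split; rewrite ?lexx ?ab// !subrr normr0 mulr0.
have supA : has_sup A by split; [exists a|exists b => t [/andP[]]].
set c := sup A.
have ac : a <= c by apply: ub_le_sup => //; case: supA.
have cb : c <= b by apply: ge_sup; [exists a|move=> t [/andP[]]].
have [|d d0 hd] := loc c; first by rewrite ac.
have [s As sc] := sup_adherent d0 supA.
have sc' : s <= c by apply: ub_le_sup => //; case: supA.
have [/andP[as_ sb] _] := As.
(* Some point of [A] lies within [d] to the left of [c], and the local bound at [c] bridges the
   gap. *)
have Ac : A c.
  apply: (step s) => //; rewrite distrC [`|G c - _|]distrC; apply: hd.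
    by rewrite as_.
  by rewrite ler0_norm ?subr_le0// opprB ltrBlDr addrC -ltrBlDr.
have [cltb|bc] := ltP c b; last first.
  have <- : c = b by apply: le_anti; rewrite cb.
  by case: Ac.
pose t := Num.min b (c + d / 2).
have ct : c < t by rewrite /t lt_min cltb/= ltrDl divr_gt0.
have tb : t <= b by rewrite /t ge_min lexx.
have td : t <= c + d / 2 by rewrite /t ge_min lexx orbT.
have : A t.
  apply: (step c) => //; first exact: ltW.
  apply: hd; first by rewrite tb (le_trans ac (ltW ct)).
  by rewrite gtr0_norm ?subr_gt0//; lra.
move=> At; have : t <= c by apply: ub_le_sup => //; case: supA.
by rewrite leNgt ct.
Qed.

Lemma cvg_sum_fin (R : realType) (T : Type) (F : set_system T) {FF : Filter F}
    (I : finType) (f : I -> T -> R) (l : I -> R) :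
  (forall i, f i @ F --> l i) -> \sum_i f i t @[t --> F] --> \sum_i l i.
Proof.
move=> fl; rewrite -fct_sumE.
elim/big_ind2 : _ => //; first exact: cvg_cst.
by move=> g1 l1 g2 l2; exact: cvgD.
Qed.

(** * Arithmetic of integrable real functions *)

Section IntegrableReal.
Context d (T : measurableType d) (R : realType).
Variables (m : {measure set T -> \bar R}) (D : set T).
Hypothesis mD : measurable D.
Implicit Types f g : T -> R.

Lemma integrable_EFinD f g :
  m.-integrable D (EFin \o f) -> m.-integrable D (EFin \o g) ->
  m.-integrable D (EFin \o (fun t => f t + g t)).
Proof.
by move=> intf intg; exact: (integrableD mD intf intg).
Qed.

Lemma integrable_EFinB f g :
  m.-integrable D (EFin \o f) -> m.-integrable D (EFin \o g) ->
  m.-integrable D (EFin \o (fun t => f t - g t)).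
Proof. by move=> intf intg; exact: (integrableB mD intf intg). Qed.

Lemma integrable_EFinZ f (c : R) :
  m.-integrable D (EFin \o f) ->
  m.-integrable D (EFin \o (fun t => c * f t)).
Proof. by move=> intf; exact: (integrableZl mD c intf). Qed.

Lemma integrable_EFin_sum (I : finType) (F : I -> T -> R) :
  (forall i, m.-integrable D (EFin \o F i)) ->
  m.-integrable D (EFin \o (fun t => \sum_i F i t)).
Proof.
move=> intF; have := @integrable_sum _ _ _ m D mD _ (index_enum I) xpredT
  (fun i => EFin \o F i) (fun i _ => intF i).
by apply: eq_integrable => // t _; rewrite /= sumEFin.
Qed.

Lemma Rintegral_sum (I : finType) (F : I -> T -> R) :
  (forall i, m.-integrable D (EFin \o F i)) ->
  \int[m]_(t in D) (\sum_i F i t) = \sum_i \int[m]_(t in D) F i t.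
Proof.
move=> intF; rewrite /Rintegral [RHS]sum_fine; last first.
  by move=> i _; exact: (integrable_fin_num mD (intF i)).
rewrite -(integral_sum mD (f := fun i => EFin \o F i) intF).
by congr fine; apply: eq_integral => t _; rewrite sumEFin.
Qed.

End IntegrableReal.

(** * Integrals over compact intervals and the square of a primitive *)

Section RealIntegrals.
Context {R : realType}.
Notation leb := (@lebesgue_measure R).
Implicit Types (f F y : R -> R) (a b s t : R).

Lemma within_continuous_dist a b F : {within `[a, b], continuous F} ->
  forall c, a <= c <= b -> forall e, 0 < e -> exists2 d, 0 < d &
    forall t, a <= t <= b -> `|t - c| < d -> `|F t - F c| < e.
Proof.
move=> /subspace_continuousP cF c cab e e0.
have := cF c; rewrite /= in_itv/= => /(_ cab) /cvgrPdist_lt /(_ e e0).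
rewrite !near_withinE => /nbhs_ballP[d /= d0 hd]; exists d => // t tab tc.
by rewrite distrC; apply: hd; rewrite /= ?in_itv//= /ball/= distrC.
Qed.

Lemma within_continuous_integrable a b F : {within `[a, b], continuous F} ->
  leb.-integrable `[a, b] (EFin \o F).
Proof. by apply: continuous_compact_integrable; exact: segment_compact. Qed.

Lemma within_continuous_measurable a b F : {within `[a, b], continuous F} ->
  measurable_fun `[a, b] F.
Proof. exact: measurable_realfun.subspace_continuous_measurable_fun. Qed.

Lemma within_continuous_bounded a b F : {within `[a, b], continuous F} ->
  [bounded F t | t in `[a, b]].
Proof.
move=> cF; have : compact (F @` `[a, b]).
  by apply: continuous_compact => //; exact: segment_compact.
move=> /compact_bounded[B [Br hB]]; exists B; split=> // x /hB h t tab.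
by apply: h; exists t.
Qed.

Lemma integrable_subitv f a b s t : a <= s -> t <= b ->
  leb.-integrable `[a, b] (EFin \o f) -> leb.-integrable `[s, t] (EFin \o f).
Proof.
move=> as_ tb; apply: integrableS => //.
by apply: subset_itvScc; rewrite bnd_simp.
Qed.

Lemma Rintegral_chasles f a s t : a <= s <= t ->
    leb.-integrable `[a, t] (EFin \o f) ->
  \int[leb]_(u in `[a, t]) f u =
  \int[leb]_(u in `[a, s]) f u + \int[leb]_(u in `[s, t]) f u.
Proof.
move=> /andP[as_ st] intf.
have := @Rintegral_itvB _ f (BLeft a) (BRight t) s intf.
rewrite !bnd_simp => /(_ as_ st) H.
rewrite -(@Rintegral_itv_obnd_cbnd _ s (BRight t)); last first.
  apply: integrableS intf => //; apply: subset_itv; rewrite bnd_simp//.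
by rewrite -H addrC subrK.
Qed.

(* On [s, t] the increment of [F ^+ 2 - 2 int F f] is the integral of
   [(F t + F s - 2 F u) f u], hence at most [e int |f|] for [s, t] close. *)
Lemma Rintegral_square f F a b : a <= b ->
    leb.-integrable `[a, b] (EFin \o f) -> {within `[a, b], continuous F} ->
    (forall t, a <= t <= b -> F t = F a + \int[leb]_(u in `[a, t]) f u) ->
  F b ^+ 2 = F a ^+ 2 + 2 * \int[leb]_(u in `[a, b]) (F u * f u).
Proof.
move=> ab intf cF Fint.
have intFf : leb.-integrable `[a, b] (EFin \o (fun u => F u * f u)).
  have -> : EFin \o (fun u => F u * f u) = ((EFin \o F) \* (EFin \o f))%E.
    by apply/funext => u.
  apply: integrableMr => //; first exact: within_continuous_measurable.
  exact: within_continuous_bounded.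
have intnf : leb.-integrable `[a, b] (EFin \o (fun u => `|f u|)).
  exact: integrable_norm.
have Finc s t : a <= s -> s <= t -> t <= b ->
    F t - F s = \int[leb]_(u in `[s, t]) f u.
  move=> as_ st tb; rewrite (Fint t) ?(Fint s) ?as_ ?tb
    ?(le_trans as_ st) ?(le_trans st tb)//.
  rewrite (@Rintegral_chasles f a s t) ?as_//; first by ring.
  exact: integrable_subitv intf.
(* The claim amounts to [phi b = phi a]; the increments of [phi] are measured against those of [G],
   the variation of [F]. *)
pose phi t := F t ^+ 2 - 2 * \int[leb]_(u in `[a, t]) (F u * f u).
pose G t := \int[leb]_(u in `[a, t]) `|f u|.
have Ginc s t : a <= s -> s <= t -> t <= b ->
    G t - G s = \int[leb]_(u in `[s, t]) `|f u|.
  move=> as_ st tb; rewrite /G (@Rintegral_chasles _ a s t) ?as_//; first by ring.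
  exact: integrable_subitv intnf.
have phiinc s t e : a <= s -> s <= t -> t <= b ->
    (forall u, s <= u <= t -> `|F t + F s - 2 * F u| <= e) ->
    `|phi t - phi s| <= e * (G t - G s).
  move=> as_ st tb he.
  have if1 : leb.-integrable `[s, t] (EFin \o f) by exact: integrable_subitv intf.
  have if2 : leb.-integrable `[s, t] (EFin \o (fun u => F u * f u)).
    exact: integrable_subitv intFf.
  have if3 : leb.-integrable `[s, t] (EFin \o (fun u => `|f u|)).
    exact: integrable_subitv intnf.
  have if4 (c : R) : leb.-integrable `[s, t] (EFin \o (fun u => c * f u)).
    exact: (integrableZl _ _ if1).
  have if5 (c : R) : leb.-integrable `[s, t] (EFin \o (fun u => c * (F u * f u))).
    exact: (integrableZl _ _ if2).
  have if6 : leb.-integrable `[s, t]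
      (EFin \o (fun u => (F t + F s) * f u - 2 * (F u * f u))).
    exact: (@integrable_EFinB _ _ R leb `[s, t] (measurable_itv _) _ _
      (if4 (F t + F s)) (if5 2)).
  (* Here [F t ^+ 2 - F s ^+ 2] is factored, and the factor [F t - F s] is written as the integral
     of [f]. *)
  have -> : phi t - phi s = \int[leb]_(u in `[s, t])
     ((F t + F s) * f u - 2 * (F u * f u)).
    rewrite RintegralB// RintegralZl// RintegralZl// -Finc// /phi.
    rewrite (@Rintegral_chasles _ a s t) ?as_//; first by ring.
    exact: integrable_subitv intFf.
  rewrite Ginc// -RintegralZl//.
  apply: le_trans (le_normr_Rintegral _ _) _ => //.
  apply: le_Rintegral => //.
  - exact: integrable_norm.
  - exact: (integrableZl _ _ if3).
  - move=> u; rewrite /= in_itv/= => ust.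
    rewrite mulrA -mulrBl normrM ler_wpM2r//; exact: he.
have Gmono : {in `[a, b] &, {homo G : s t / s <= t}}.
  move=> s t; rewrite !in_itv/= => /andP[as_ _] /andP[_ tb] st.
  by rewrite -subr_ge0 Ginc//; apply: Rintegral_ge0.
(* Near [c] the values of [F] are within [e / 4] of [F c], so [F t + F c - 2 * F u] stays below
   [3 * e / 4]. *)
have key e : 0 < e -> `|phi b - phi a| <= e * (G b - G a).
  move=> e0; apply: straddle_bound => //; first exact: ltW.
  move=> c cab; have e4 : 0 < e / 4 by rewrite divr_gt0.
  have [d d0 hd] := within_continuous_dist cF cab e4.
  exists d => // t /andP[at_ tb] tc.
  move/andP: (cab) => [ac cb].
  have Fd u : a <= u -> u <= b -> `|u - c| < d -> `|F u - F c| < e / 4.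
    by move=> au ub; apply: hd; rewrite au.
  have ht := Fd t at_ tb tc.
  have aux u : a <= u -> u <= b -> `|u - c| < d ->
      `|F t + F c - 2 * F u| <= e.
    move=> au ub uc; have := Fd u au ub uc; move: ht.
    rewrite !ltr_norml => /andP[h1 h2] /andP[h3 h4].
    by rewrite ler_norml; lra.
  have [ct|/ltW tc'] := leP c t.
    have Gct : 0 <= G t - G c by rewrite subr_ge0 Gmono ?in_itv//= ?ac ?at_.
    rewrite (ger0_norm Gct); apply: phiinc => // u /andP[cu ut].
    apply: aux; rewrite ?(le_trans ac cu) ?(le_trans ut tb)//.
    by move: tc; rewrite !ger0_norm ?subr_ge0//; lra.
  have Gct : 0 <= G c - G t by rewrite subr_ge0 Gmono ?in_itv//= ?ac ?at_.
  rewrite distrC [`|G t - _|]distrC (ger0_norm Gct).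
  apply: phiinc => // u /andP[tu uc]; rewrite [F c + _]addrC.
  apply: aux; rewrite ?(le_trans at_ tu) ?(le_trans uc cb)//.
  by move: tc; rewrite !ler0_norm ?subr_le0//; lra.
have : `|phi b - phi a| <= 0.
  rewrite leNgt; apply/negP => p0.
  have Gab : 0 <= G b - G a by rewrite subr_ge0 Gmono ?in_itv//= ?lexx ?ab.
  (* With this [e], the bound is at most half of the increment it should dominate, a contradiction;
     the added 1 guards against [G b = G a]. *)
  have /key : 0 < `|phi b - phi a| / 2 / (1 + (G b - G a)).
    by rewrite !divr_gt0// ltr_pwDl.
  rewrite mulrAC -mulrA.
  set g := G b - G a in Gab *; set p := `|_| in p0 *.
  have : g / (1 + g) <= 1 by rewrite ler_pdivrMr ?ltr_pwDl//; lra.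
  by move: (g / (1 + g)) => q q1 h; nra.
rewrite normr_le0 subr_eq0 => /eqP; rewrite /phi set_itv1 Rintegral_set1.
move=> H.
rewrite -[F b ^+ 2](subrK (2 * \int[leb]_(u in `[a, b]) (F u * f u))) H.
by rewrite mulr0 subr0.
Qed.

End RealIntegrals.

(** * Gronwall's inequality, backwards in time *)

(** Let [G] be the left-hand side of the hypothesis. Then [G' = - kap * y <= - (kap / c) * G], so
    [exp(kap t / c) G(t)] does not increase; its values at [T] and 0 are compared. *)
Lemma backward_gronwall (R : realType) (y : R -> R) (T A kap c : R) :
    0 < T -> 0 < c -> 0 <= kap ->
    {within `[0, T], continuous y} ->
    (forall t, 0 <= t <= T ->
      A + kap * \int[@lebesgue_measure R]_(u in `[t, T]) y u <= c * y t) ->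
  A <= expR (- (kap / c) * T) * (c * y 0).
Proof.
move=> T0 c0 kap0 cy hy.
have inty := within_continuous_integrable cy.
(* The fundamental theorem differentiates in the upper limit, so the tail integral is written
   [H T - H t]. *)
pose H t := \int[@lebesgue_measure R]_(u in `[0, t]) y u.
pose G t := A + kap * (H T - H t).
have Gle t : 0 <= t <= T -> G t <= c * y t.
  move=> /andP[t0 tT]; rewrite /G /H (@Rintegral_chasles _ _ 0 t T) ?t0//.
  by rewrite addrAC subrr add0r; apply: hy; rewrite t0.
pose E t := expR (kap / c * t) * G t.
have dH t : t \in `]0, T[ -> is_derive t (1 : R) H (y t).
  rewrite in_itv/= => /andP[t0 tT].
  have cyt : {for t, continuous y}.
    by apply: (within_continuous_continuous T0 cy); rewrite in_itv/= t0.
  have [] := continuous_FTC1_closed tT inty t0 cyt.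
  by rewrite derive1E => + <-; exact: derivableP.
have dE t : t \in `]0, T[ -> is_derive t (1 : R) E
    (expR (kap / c * t) * (kap / c * G t - kap * y t)).
  move=> tT; have dHt := dH t tT.
  rewrite /E /G; apply: is_derive_eq.
  by rewrite !scaler1 /GRing.scale/=; ring.
have cH : {within `[0, T], continuous H}.
  exact: (parameterized_integral_continuous (ltW T0) inty).
have cE : {within `[0, T], continuous E}.
  move=> t; apply: cvgM.
    apply: continuous_subspaceT => u.
    apply: continuous_comp; last exact: continuous_expR.
    by apply: cvgM; [exact: cvg_cst|exact: cvg_id].
  apply: cvgD; first exact: cvg_cst.
  apply: cvgM; first exact: cvg_cst.
  by apply: cvgB; [exact: cvg_cst|exact: cH].
have : E T <= E 0.
  have dE1 t : t \in `]0, T[ -> derivable E t 1 by move=> /dE[].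
  have dE2 t : t \in `]0, T[ -> derive1 E t <= 0.
    move=> tT; have dEt := dE t tT; rewrite derive1E (@derive_val _ _ _ _ _ _ _ dEt).
    rewrite pmulr_rle0 ?expR_gt0// subr_le0.
    have /Gle h : 0 <= t <= T by move: tT; rewrite in_itv/= => /andP[/ltW-> /ltW->].
    have bet0 : 0 <= kap / c by rewrite divr_ge0// ltW.
    apply: le_trans (ler_wpM2l bet0 h) _.
    by rewrite mulrA divfK// gt_eqF.
  have T0' := ltW T0.
  by apply: (ler0_derive1_le_cc dE1 dE2 cE) => //; rewrite in_itv/= lexx T0'.
have G0 := Gle 0; rewrite lexx (ltW T0) in G0.
rewrite /E mulr0 expR0 mul1r {1}/G subrr mulr0 addr0 => h.
rewrite mulNr expRN mulrC ler_pdivlMr ?expR_gt0// mulrC.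
exact: le_trans h (G0 isT).
Qed.

(** * The matrix exponential, which continues trajectories with zero disturbance *)

Section LinearFlow.
Context {R : realType} {n : nat}.
Variable A : 'M[R]_n.
Implicit Types (x : 'cV[R]_n) (t : R).

Definition flow_coeff x i (m : nat) : R := iter m (mulmx A) x i 0 / m`!%:R.

(** This is exp(t A) x, with one scalar power series per coordinate so that termwise differentiation
    of scalar series applies. *)
Definition linear_flow x t : 'cV[R]_n := \col_i limn (pseries (flow_coeff x i) t).

(** Differentiation multiplies coefficient [m + 1] by [m + 1], which cancels in the factorial and
    leaves one more factor [A]. *)
Lemma flow_coeff_diffs x i : pseries_diffs (flow_coeff x i) = flow_coeff (A *m x) i.
Proof.
apply/funext => m; rewrite /pseries_diffs /flow_coeff -iterSr.
by rewrite factS natrM invfM mulrCA mulVKf ?pnatr_eq0.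
Qed.

Lemma flow_coeff_mulmx x i m :
  flow_coeff (A *m x) i m = \sum_j A i j * flow_coeff x j m.
Proof.
rewrite /flow_coeff -iterSr iterS mxE mulr_suml.
by apply: eq_bigr => j _; rewrite mulrA.
Qed.

(** By induction: applying [A] multiplies a common bound on the coordinates by at most an absolute
    row sum, hence by at most the absolute sum of all entries. *)
Lemma flow_coeff_le x i m :
  `|flow_coeff x i m| <=
    (\sum_j `|x j 0|) * ((\sum_j \sum_l `|A j l|) ^+ m / m`!%:R).
Proof.
rewrite /flow_coeff normrM normfV normr_nat mulrA ler_wpM2r ?invr_ge0//.
elim: m i => [|m IH] i /=.
  by rewrite expr0 mulr1 (bigD1 i)//= lerDl sumr_ge0.
rewrite mxE (le_trans (ler_norm_sum _ _ _))//.
set X := \sum_j `|x j 0|; set B := \sum_j \sum_l _.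
have B0 : 0 <= B by apply: sumr_ge0 => j _; apply: sumr_ge0.
apply: (@le_trans _ _ (\sum_l `|A i l| * (X * B ^+ m))).
  by apply: ler_sum => l _; rewrite normrM ler_wpM2l.
rewrite -mulr_suml exprS (mulrCA X) ler_wpM2r//.
  by rewrite mulr_ge0 ?exprn_ge0//; exact: sumr_ge0.
by rewrite [leRHS](bigD1 i)//= lerDl sumr_ge0// => j _; apply: sumr_ge0.
Qed.

(** Absolute convergence, by comparison with a multiple of the exponential series at [B * |t|]. *)
Lemma is_cvg_flow x i t : cvgn (pseries (flow_coeff x i) t).
Proof.
apply: normed_cvg.
set B := \sum_j \sum_l `|A j l|.
apply: (@series_le_cvg _ _ ((\sum_j `|x j 0|) *: exp_coeff (B * `|t|))).
- by move=> m; exact: normr_ge0.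
- move=> m; apply: mulr_ge0; first exact: sumr_ge0.
  apply: exp_coeff_ge0; rewrite mulr_ge0//.
  by apply: sumr_ge0 => j _; apply: sumr_ge0.
- move=> m; rewrite /= normrM normrX.
  apply: (le_trans (ler_wpM2r _ (flow_coeff_le _ _ _))).
    by rewrite exprn_ge0.
  by rewrite -mulrA /GRing.scale/= /exp_coeff/= exprMn mulrAC.
- by apply: is_cvg_seriesZ; exact: is_cvg_series_exp_coeff.
Qed.

Lemma linear_flow0 x : linear_flow x 0 = x.
Proof.
apply/colP => i; rewrite mxE /pseries.
apply: (@lim_near_cst _ _ _ _ _ (x i 0)) => //.
(* The partial sum of index 0 is empty; from index 1 on only the constant term is nonzero at time
   0. *)
exists 1%N => // m /= m1.
rewrite /series/= -(subnK m1) addn1 big_nat_recl//= expr0 mulr1.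
rewrite {1}/flow_coeff /= fact0 divr1 big1 ?addr0// => j _.
by rewrite expr0n mulr0.
Qed.

(** [A] acts on the coefficients through finite sums, which commute with partial sums and with
    limits. *)
Lemma linear_flow_mulmx x t i :
  linear_flow (A *m x) t i 0 = (A *m linear_flow x t) i 0.
Proof.
rewrite !mxE.
have -> : pseries (flow_coeff (A *m x) i) t =
    (fun m => \sum_j A i j * pseries (flow_coeff x j) t m).
  apply/funext => m; rewrite /pseries /series/=.
  under eq_bigr do rewrite flow_coeff_mulmx mulr_suml.
  rewrite exchange_big/=; apply: eq_bigr => j _; rewrite mulr_sumr.
  by apply: eq_bigr => l _; rewrite mulrA.
apply/cvg_lim => //.
apply: (@cvg_sum_fin _ _ _ _ _ (fun j m => A i j * pseries (flow_coeff x j) t m)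
  (fun j => A i j * linear_flow x t j 0)) => j.
rewrite mxE; apply: cvgM; first exact: cvg_cst.
exact: is_cvg_flow.
Qed.

Lemma is_derive_linear_flow x i t : is_derive t (1 : R)
  (fun s => linear_flow x s i 0) ((A *m linear_flow x t) i 0).
Proof.
rewrite -linear_flow_mulmx mxE -flow_coeff_diffs.
have -> : (fun s => linear_flow x s i 0) =
    (fun s => limn (pseries (flow_coeff x i) s)).
  by apply/funext => s; rewrite mxE.
(* The series converges everywhere, so any radius beyond [|t|] will do. *)
apply: (@pseries_snd_diffs _ _ (`|t| + 1)); rewrite ?flow_coeff_diffs;
  try exact: is_cvg_flow.
by rewrite [ltRHS]ger0_norm ?addr_ge0// ltrDl.
Qed.

Lemma continuous_linear_flow x i : continuous (fun t => linear_flow x t i 0).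
Proof.
move=> t; apply: differentiable_continuous; apply/derivable1_diffP.
by have [] := is_derive_linear_flow x i t.
Qed.

(** The start time [a] is general because the flow takes over at the end of the horizon of a given
    trajectory. *)
Lemma Rintegral_linear_flow x i a t : a <= t ->
  linear_flow x (t - a) i 0 = x i 0 +
    \int[@lebesgue_measure R]_(s in `[a, t]) (A *m linear_flow x (s - a)) i 0.
Proof.
have shift s : is_derive s (1 : R) (fun s => linear_flow x (s - a) i 0)
    ((A *m linear_flow x (s - a)) i 0).
  have dflow := is_derive_linear_flow x i (s - a).
  have dshift : is_derive s (1 : R) (fun s => s - a) 1.
    by apply: is_derive_eq; rewrite subr0.
  have := @is_derive1_comp R (fun u => linear_flow x u i 0) (fun u => u - a) s _ _
    dflow dshift.
  by rewrite mulr1.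
have cont y j : continuous (fun s => linear_flow y (s - a) j 0).
  move=> s; apply: (@continuous_comp _ _ _ (fun s => s - a)
    (fun s => linear_flow y s j 0)); last exact: continuous_linear_flow.
  by apply: cvgB; [exact: cvg_id|exact: cvg_cst].
rewrite le_eqVlt => /predU1P[<-|a_t].
  by rewrite subrr linear_flow0 set_itv1 Rintegral_set1 addr0.
rewrite /Rintegral (@continuous_FTC2 _ _ (fun s => linear_flow x (s - a) i 0))//.
- by rewrite subrr linear_flow0 /= addrCA subrr addr0.
- apply: continuous_subspaceT => s; under eq_fun do rewrite -linear_flow_mulmx.
  exact: cont.
- split.
  + by move=> s _; have [] := shift s.
  + exact/cvg_at_right_filter/cont.
  + exact/cvg_at_left_filter/cont.
- by move=> s _; rewrite derive1E (@derive_val _ _ _ _ _ _ _ (shift s)).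
Qed.

End LinearFlow.

Lemma within_continuous_col (R : realType) (n : nat) (E : set R)
    (xi : R -> 'cV[R]_n) :
  (forall i, {within E, continuous (fun t => xi t i 0)}) ->
  {within E, continuous xi}.
Proof.
move=> cxi; apply/subspace_continuousP => t Et; apply/cvg_ballP => e e0.
have : \forall s \near within E (nbhs t), forall i, ball (xi t i 0) e (xi s i 0).
  apply: filter_forall => i; have /subspace_continuousP/(_ t Et) := cxi i.
  by move/cvg_ballP => /(_ e e0).
by apply: filterS => s hs; split => // i j; rewrite ord1.
Qed.

(** * Integrability along controlled trajectories *)

Section Controlled.
Context {R : realType} {M n k : nat}.
Variable S : system R M n k.
Notation leb := (@lebesgue_measure R).
Implicit Types (w : R -> 'cV[R]_k) (mu : R -> 'I_M) (xi : R -> 'cV[R]_n).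

(** The common finite-horizon content of the constraints in [value] and [semigroup], so that the
    same estimates serve both. *)
Definition controls (T : R) w mu :=
  [/\ forall j, measurable_fun (`[0, T] : set R) (fun t => w t j 0),
      leb.-integrable `[0, T] (EFin \o (fun t => enorm (w t) ^+ 2))
    & switching `[0, T] mu].

Lemma switchingS (E E' : set R) mu : measurable E' -> E' `<=` E ->
  switching E mu -> switching E' mu.
Proof.
move=> mE' EE' sw Y; rewrite -(setIidl EE') -setIA.
exact: measurableI.
Qed.

(** The added time contributes to a preimage either the point [T] or nothing, measurable in both
    cases. *)
Lemma switching_cc (T : R) mu : 0 <= T ->
  switching `[0, T[ mu -> switching `[0, T] mu.
Proof.
move=> T0 sw Y; rewrite -(@setUitv1 _ _ _ _ true) ?bnd_simp// setIUl.
apply: measurableU => //.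
have [TY|TY] := pselect (Y (mu T)).
  by rewrite setIidl// => _ ->.
by rewrite (_ : _ `&` _ = set0)//; rewrite -subset0 => _ [->].
Qed.

Lemma trajectoryS (E E' : set R) w mu x xi : E' `<=` E ->
  trajectory S E w mu x xi -> trajectory S E' w mu x xi.
Proof.
move=> EE' [cxi eqxi]; split; last by move=> t i /EE'; exact: eqxi.
exact: continuous_subspaceW cxi.
Qed.

Lemma disturbance_controls w mu (T : R) :
  disturbance w -> switching `[0, T] mu -> controls T w mu.
Proof.
move=> [mw iw] sw; have mwT j : measurable_fun (`[0, T] : set R) (fun t => w t j 0).
  apply: measurable_funS (mw j) => // t /=.
  by rewrite !in_itv/= => /andP[-> _].
have mw2 : measurable_fun (`[0, T] : set R) (fun t => enorm (w t) ^+ 2).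
  rewrite (funext (fun t => sqr_enorm (w t))).
  by apply: (@measurable_sum _ _ _ _ _ _ (fun j t => w t j 0 ^+ 2)) => j;
    apply: measurable_funX.
split => //; apply/integrableP; split; first exact/measurable_EFinP.
under eq_integral do rewrite /= ger0_norm ?sqr_ge0//.
exact: iw.
Qed.

Lemma trajectory_start w mu x xi (T : R) : 0 <= T ->
  trajectory S `[0, T] w mu x xi -> xi 0 = x.
Proof.
move=> T0 [_ eqxi]; apply/colP => i; rewrite eqxi/= ?in_itv/= ?lexx//.
by rewrite set_itv1 Rintegral_set1 addr0.
Qed.

Lemma within_continuous_coord (E : set R) xi i : {within E, continuous xi} ->
  {within E, continuous (fun t => xi t i 0)}.
Proof.
move=> cxi t; exact: (@continuous_comp (subspace E) _ _ xi
  (fun v : 'cV[R]_n => v i 0) t (cxi t) (@coord_continuous _ _ _ i 0 (xi t))).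
Qed.

Lemma within_continuous_enorm_sqr (E : set R) xi : {within E, continuous xi} ->
  {within E, continuous (fun t => enorm (xi t) ^+ 2)}.
Proof.
move=> cxi; under eq_fun do rewrite sqr_enorm.
move=> t; apply: (@cvg_sum_fin R (subspace E) (nbhs (t : subspace E))
  (nbhs_filter (t : subspace E)) _
  (fun i t => xi t i 0 ^+ 2)) => i.
by apply: cvgM; exact: within_continuous_coord.
Qed.

Section Fixed.
Variables (T : R) (w : R -> 'cV[R]_k) (mu : R -> 'I_M) (xi : R -> 'cV[R]_n).
Hypotheses (ctrl : controls T w mu) (cxi : {within `[0, T], continuous xi}).

(** There are finitely many modes, so the factor [f (mu t)] is measurable and bounded. *)
Lemma integrable_modeM (f : 'I_M -> R) (g : R -> R) :
  leb.-integrable `[0, T] (EFin \o g) ->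
  leb.-integrable `[0, T] (EFin \o (fun t => f (mu t) * g t)).
Proof.
move=> intg; have [_ _ sw] := ctrl.
have mh : measurable_fun (`[0, T] : set R) (f \o mu).
  by move=> _ Y _; exact: (sw (f @^-1` Y)).
have bh : [bounded (f \o mu) t | t in (`[0, T] : set R)].
  exists (\sum_m `|f m|); split; first exact: num_real.
  move=> B fB t _ /=; apply: (le_trans _ (ltW fB)).
  by rewrite (bigD1 (mu t))//= lerDl sumr_ge0.
exact: (@integrableMr _ _ R leb `[0, T] (measurable_itv _) (f \o mu) (EFin \o g)).
Qed.

(** On a bounded interval square integrability suffices, since |w_j| <= 1 + |w|^2. *)
Lemma integrable_control j : leb.-integrable `[0, T] (EFin \o (fun t => w t j 0)).
Proof.
have [mw iw _] := ctrl.
have i1 : leb.-integrable `[0, T] (EFin \o (fun t : R => 1 + enorm (w t) ^+ 2)).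
  apply: integrable_EFinD => //; apply: within_continuous_integrable.
  by apply: continuous_subspaceT => t; exact: cvg_cst.
have mwE : measurable_fun (`[0, T] : set R) (EFin \o (fun t => w t j 0)).
  by apply/measurable_EFinP; exact: mw.
apply: (@le_integrable _ _ R leb `[0, T] (measurable_itv _) _ _ mwE _ i1).
move=> t _; rewrite /= lee_fin (le_trans (coord_le_enorm _ _))//.
rewrite [leRHS]ger0_norm ?addr_ge0 ?sqr_ge0//.
have := sqr_ge0 (enorm (w t) - 1); have := enorm_ge0 (w t).
by move: (enorm (w t)) => e e0; rewrite !expr2; nra.
Qed.

Lemma integrable_velocity i :
  leb.-integrable `[0, T] (EFin \o (fun t => velocity S w mu xi t i 0)).
Proof.
have -> : (fun t => velocity S w mu xi t i 0) = (fun t =>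
    \sum_j drift S (mu t) i j * xi t j 0 + \sum_j diffusion S (mu t) i j * w t j 0).
  by apply/funext => t; rewrite /velocity !mxE.
apply: integrable_EFinD => //; apply: integrable_EFin_sum => // j.
- apply: (@integrable_modeM (fun m => drift S m i j)).
  exact/within_continuous_integrable/within_continuous_coord.
- by apply: (@integrable_modeM (fun m => diffusion S m i j)); exact: integrable_control.
Qed.

Lemma integrable_coord_velocity i : leb.-integrable `[0, T]
  (EFin \o (fun t => xi t i 0 * velocity S w mu xi t i 0)).
Proof.
have cxii := @within_continuous_coord `[0, T] xi i cxi.
exact: (@integrableMr _ _ R leb `[0, T] (measurable_itv _) (fun t => xi t i 0)
  (EFin \o (fun t => velocity S w mu xi t i 0))
  (within_continuous_measurable cxii) (within_continuous_bounded cxii)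
  (integrable_velocity i)).
Qed.

Lemma integrable_power :
  leb.-integrable `[0, T] (EFin \o
    (fun t => \sum_i xi t i 0 * velocity S w mu xi t i 0)).
Proof.
apply: integrable_EFin_sum => // i; exact: integrable_coord_velocity.
Qed.

Lemma integrable_running :
  leb.-integrable `[0, T] (EFin \o running S w mu xi).
Proof.
rewrite /running; apply: integrable_EFinB => //; last first.
  by apply: integrable_EFinZ => //; have [] := ctrl.
(* Expanded entrywise, the form is a sum of mode-dependent coefficients times continuous functions,
   as [integrable_modeM] expects. *)
have -> : (fun t => 2^-1 * qform (cost S (mu t)) (xi t)) = (fun t =>
    2^-1 * \sum_i \sum_j cost S (mu t) i j * (xi t i 0 * xi t j 0)).
  apply/funext => t; rewrite qformE; congr (_ * _); apply: eq_bigr => i _.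
  by rewrite mxE mulr_sumr; apply: eq_bigr => j _; rewrite mulrCA.
apply: integrable_EFinZ => //; apply: integrable_EFin_sum => // i.
apply: integrable_EFin_sum => // j.
apply: (@integrable_modeM (fun m => cost S m i j)).
apply: within_continuous_integrable => t.
by apply: cvgM; exact: within_continuous_coord.
Qed.

Lemma payoffE (t : R) : 0 <= t <= T ->
  payoff S t w mu xi = (\int[leb]_(s in `[0, t]) running S w mu xi s)%:E.
Proof.
move=> /andP[_ tT]; rewrite /payoff /Rintegral fineK//.
apply: integrable_fin_num => //; exact: integrable_subitv integrable_running.
Qed.

End Fixed.
End Controlled.

(** * Energy estimates and continuation of trajectories *)

Section Energy.
Context {R : realType} {M n k : nat}.
Variable S : system R M n k.
Notation leb := (@lebesgue_measure R).
Implicit Types (w : R -> 'cV[R]_k) (mu : R -> 'I_M) (xi : R -> 'cV[R]_n).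

(** [xi] need not be differentiable everywhere, but each coordinate is a primitive of its velocity,
    and [Rintegral_square] replaces the chain rule. *)
Lemma energy_balance (T : R) w mu xi x (s t : R) :
    controls T w mu -> trajectory S `[0, T] w mu x xi ->
    0 <= s -> s <= t -> t <= T ->
  enorm (xi t) ^+ 2 = enorm (xi s) ^+ 2 +
    2 * \int[leb]_(u in `[s, t]) (\sum_i xi u i 0 * velocity S w mu xi u i 0).
Proof.
move=> ctrl [cxi eqxi] s0 st tT.
have subst : `[s, t] `<=` `[0, T].
  by apply: subset_itvScc; rewrite bnd_simp.
have cxist i : {within `[s, t], continuous (fun u => xi u i 0)}.
  by apply: within_continuous_coord; exact: continuous_subspaceW cxi.
have intv i : leb.-integrable `[s, t] (EFin \o (fun u => velocity S w mu xi u i 0)).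
  exact: integrable_subitv (integrable_velocity S ctrl cxi i).
have intxv i : leb.-integrable `[s, t]
    (EFin \o (fun u => xi u i 0 * velocity S w mu xi u i 0)).
  exact: integrable_subitv (integrable_coord_velocity S ctrl cxi i).
rewrite !sqr_enorm Rintegral_sum// mulr_sumr -big_split/=.
apply: eq_bigr => i _; apply: Rintegral_square => // u /andP[su ut].
have u0 := le_trans s0 su; have uT := le_trans ut tT.
have sT := le_trans st tT.
rewrite !eqxi/= ?in_itv/= ?s0 ?u0//= -addrA.
rewrite -Rintegral_chasles ?s0//.
exact: integrable_subitv (integrable_velocity S ctrl cxi i).
Qed.

(** Integrates [running_velocity_le]; [energy_balance] turns the velocity term into a difference of
    energies. *)
Lemma energy_dissipation (T cA cs cD l : R) w mu xi x (s t : R) :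
    0 < gain S -> assumptionA1 S cA cs cD -> 0 < l ->
    controls T w mu -> trajectory S `[0, T] w mu x xi ->
    0 <= s -> s <= t -> t <= T ->
  l / 2 * enorm (xi t) ^+ 2 + \int[leb]_(u in `[s, t]) running S w mu xi u <=
  l / 2 * enorm (xi s) ^+ 2 +
    residual S cA cs cD l / 2 * \int[leb]_(u in `[s, t]) enorm (xi u) ^+ 2.
Proof.
move=> g0 hA l0 ctrl traj s0 st tT.
rewrite (energy_balance ctrl traj s0 st tT); have [cxi _] := traj.
set d := fun u => \sum_i xi u i 0 * velocity S w mu xi u i 0.
have cxist : {within `[s, t], continuous xi}.
  by apply: continuous_subspaceW cxi; apply: subset_itvScc; rewrite bnd_simp.
have intd : leb.-integrable `[s, t] (EFin \o d).
  exact: integrable_subitv (integrable_power S ctrl cxi).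
have intr : leb.-integrable `[s, t] (EFin \o running S w mu xi).
  exact: integrable_subitv (integrable_running S ctrl cxi).
have intx : leb.-integrable `[s, t] (EFin \o (fun u => enorm (xi u) ^+ 2)).
  exact/within_continuous_integrable/within_continuous_enorm_sqr.
have intld : leb.-integrable `[s, t] (EFin \o (fun u => l * d u)).
  exact: (@integrable_EFinZ _ _ R leb `[s, t] (measurable_itv _) d l intd).
have : \int[leb]_(u in `[s, t]) (l * d u + running S w mu xi u) <=
    \int[leb]_(u in `[s, t]) (residual S cA cs cD l / 2 * enorm (xi u) ^+ 2).
  apply: le_Rintegral => //.
  - exact: (@integrable_EFinD _ _ R leb `[s, t] (measurable_itv _) _ _ intld intr).
  - exact: (@integrable_EFinZ _ _ R leb `[s, t] (measurable_itv _) _ _ intx).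
  - by move=> u _; exact: (running_velocity_le w mu xi u g0 hA l0).
rewrite RintegralD//.
rewrite !RintegralZl//.
move: (\int[leb]_(u in _) d u) (\int[leb]_(u in _) running _ _ _ _ u).
by move=> a b; lra.
Qed.

(** After [T] the mode is frozen at [m0], so the continuation is the explicit flow of [drift S m0]
    from [xi T]. *)
Lemma free_extension (T : R) w mu xi x (m0 : 'I_M) : 0 <= T ->
    controls T w mu -> trajectory S `[0, T] w mu x xi ->
  exists w' mu' xi',
    [/\ disturbance w', switching `[0, +oo[ mu',
        trajectory S `[0, +oo[ w' mu' x xi',
        forall t, t <= T -> [/\ w' t = w t, mu' t = mu t & xi' t = xi t]
      & forall t, T < t -> w' t = 0].
Proof.
move=> T0 ctrl [cxi eqxi]; have [mw iw sw] := ctrl.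
pose w' t := if t <= T then w t else 0.
pose mu' t := if t <= T then mu t else m0.
pose xi' t := if t <= T then xi t else linear_flow (drift S m0) (xi T) (t - T).
have w'T t : t <= T -> w' t = w t by rewrite /w' => ->.
have mu'T t : t <= T -> mu' t = mu t by rewrite /mu' => ->.
have xi'T t : t <= T -> xi' t = xi t by rewrite /xi' => ->.
have split0 : `[0, +oo[%classic = `[0, T] `|` `]T, +oo[.
  by rewrite -itv_bndbnd_setU ?bnd_simp.
have dw' : disturbance w'.
  split=> [j|b].
    rewrite split0; apply/measurable_funU => //; split.
      apply: eq_measurable_fun (mw j) => t; rewrite inE/= in_itv/= => /andP[_ tT].
      by rewrite w'T.
    have m0w : measurable_fun (`]T, +oo[%classic : set R) (fun _ : R => 0 : R).
      exact: measurable_cst.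
    apply: eq_measurable_fun m0w => t.
    by rewrite inE/= in_itv/= andbT ltNge /w' => /negbTE ->; rewrite mxE.
  set g := fun t => (enorm (w t) ^+ 2)%:E.
  (* [w'] vanishes beyond [T], so only an integral of |w|^2 over a subset of [0, T] remains. *)
  rewrite [ltLHS](_ : _ = (\int[leb]_(t in `[0%R, b]) (g \_ `[0%R, T]) t)%E);
    last first.
    apply: eq_integral => t; rewrite inE/= in_itv/= => /andP[t0 _].
    rewrite patchE mem_setE in_itv/= t0/= /w'.
    by case: leP => // _; rewrite enorm0 expr0n.
  rewrite -integral_mkcondr.
  have := @integrable_lty _ _ R leb `[0, T] (measurable_itv _) _ iw.
  apply: le_lt_trans.
  apply: ge0_subset_integral => //; first by apply: measurableI.
    exact: measurable_int iw.
  by move=> t _; rewrite lee_fin sqr_ge0.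
have sw' : switching `[0, +oo[ mu'.
  move=> Y; rewrite split0 setIUl; apply: measurableU.
    rewrite (_ : _ `&` _ = `[0, T] `&` mu @^-1` Y)//.
    by apply/seteqP; split=> t /= []; rewrite in_itv/= => /andP[-> tT]; rewrite mu'T.
  have [Ym|Ym] := pselect (Y m0).
    rewrite setIidl// => t /=; rewrite in_itv/= andbT ltNge /mu' => /negbTE ->//.
  rewrite (_ : _ `&` _ = set0)// -subset0 => t /= [].
  by rewrite in_itv/= andbT ltNge /mu' => /negbTE ->.
have cxi' : {within `[0, +oo[, continuous xi'}.
  (* Gluing continuous functions requires closed pieces; these share [T], where [linear_flow0] makes
     the two branches agree. *)
  have -> : `[0, +oo[%classic = `[0, T] `|` `[T, +oo[.
    apply/seteqP; split=> t /=; rewrite !in_itv/= !andbT.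
      by move=> t0; have [tT|/ltW tT] := leP t T; [left; rewrite t0|right].
    by move=> [/andP[]//|]; exact: le_trans.
  apply: withinU_continuous; [exact: interval_closed|exact: rray_closed| |].
    have exi : {in `[0, T]%classic, xi =1 xi'}.
      by move=> t; rewrite inE/= in_itv/= => /andP[_ tT]; rewrite xi'T.
    exact: (subspace_eq_continuous exi cxi).
  have cflow : {within `[T, +oo[, continuous
      (fun t => linear_flow (drift S m0) (xi T) (t - T))}.
    apply: within_continuous_col => i; apply: continuous_subspaceT => t.
    apply: (@continuous_comp _ _ _ (fun t => t - T)
      (fun s => linear_flow (drift S m0) (xi T) s i 0)); last exact: continuous_linear_flow.
    by apply: cvgB; [exact: cvg_id|exact: cvg_cst].
  have exi : {in `[T, +oo[%classic,
      (fun t => linear_flow (drift S m0) (xi T) (t - T)) =1 xi'}.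
    move=> t; rewrite inE/= in_itv/= andbT /xi'.
    by case: ltgtP => // -> _; rewrite subrr linear_flow0.
  exact: (subspace_eq_continuous exi cflow).
have tr' : trajectory S `[0, +oo[ w' mu' x xi'.
  split=> // t i /=; rewrite in_itv/= andbT => t0.
  (* Up to [T] the integral equation is the old one. Later the integral is cut at [T]: the first
     part yields [xi T], the second the increment of the flow. *)
  have [tT|Tt] := leP t T.
    rewrite xi'T// eqxi/= ?in_itv/= ?t0//; congr (_ + _); apply: eq_Rintegral => s.
    by rewrite inE/= in_itv/= => /andP[_ st]; rewrite xi'T ?mu'T ?w'T ?(le_trans st).
  have ctrl' : controls t w' mu'.
    apply: disturbance_controls => //; apply: switchingS sw' => //.
    exact: subset_itvl.
  have cxit : {within `[0, t], continuous xi'}.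
    by apply: continuous_subspaceW cxi'; exact: subset_itvl.
  have intv := integrable_velocity S ctrl' cxit i.
  have := @Rintegral_itvB R _ (BLeft 0) (BRight t) T intv.
  rewrite !bnd_simp => /(_ T0 (ltW Tt)) /eqP; rewrite subr_eq => /eqP ->.
  have -> : xi' t = linear_flow (drift S m0) (xi T) (t - T) by rewrite /xi' leNgt Tt.
  rewrite (Rintegral_linear_flow _ _ _ (ltW Tt)).
  rewrite eqxi/= ?in_itv/= ?T0 ?lexx// -addrA; congr (_ + _).
  rewrite addrC; congr (_ + _).
    (* The point [T] is dropped because [w'] and [mu'] still take the values of [w] and [mu]
       there. *)
    rewrite -Rintegral_itv_obnd_cbnd; last first.
      apply: (@integrableS _ _ R leb `[T, t]) => //.
        by apply: subset_itvr; rewrite bnd_simp.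
      apply: within_continuous_integrable; apply: continuous_subspaceT => s.
      under eq_fun do rewrite -linear_flow_mulmx.
      apply: (@continuous_comp _ _ _ (fun s => s - T)
        (fun s => linear_flow (drift S m0) (drift S m0 *m xi T) s i 0)).
        by apply: cvgB; [exact: cvg_id|exact: cvg_cst].
      exact: continuous_linear_flow.
    apply: eq_Rintegral => s; rewrite inE/= in_itv/= => /andP[Ts _].
    by rewrite /velocity /xi' /mu' /w' leNgt Ts/= mulmx0 addr0.
  apply: eq_Rintegral => s; rewrite inE/= in_itv/= => /andP[_ sT].
  by rewrite /velocity xi'T ?mu'T ?w'T.
exists w', mu', xi'; split => // t tT; first by rewrite w'T ?mu'T ?xi'T.
by rewrite /w' leNgt tT.
Qed.

End Energy.

(** * Bounds on the value function and the semigroup *)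

Section ValueFunction.
Context {R : realType} {M n k : nat}.
Variable S : system R M n k.
Notation leb := (@lebesgue_measure R).
Implicit Types (w : R -> 'cV[R]_k) (mu : R -> 'I_M) (xi : R -> 'cV[R]_n).

Lemma infinite_horizon w mu x xi (T : R) :
    disturbance w -> switching `[0, +oo[ mu ->
    trajectory S `[0, +oo[ w mu x xi ->
  controls T w mu /\ trajectory S `[0, T] w mu x xi.
Proof.
move=> dw sw tr; have T_oo : `[0, T] `<=` `[0, +oo[ by exact: subset_itvl.
split; last exact: trajectoryS tr.
by apply: disturbance_controls => //; apply: switchingS sw.
Qed.

Lemma finite_horizon w mu (T : R) : 0 <= T ->
    disturbance w -> switching `[0, T[ mu -> controls T w mu.
Proof.
by move=> T0 dw sw; apply: disturbance_controls => //; exact: switching_cc.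
Qed.

Lemma value_ge (x : 'cV[R]_n) w mu xi (T : R) :
    disturbance w -> switching `[0, +oo[ mu ->
    trajectory S `[0, +oo[ w mu x xi -> 0 < T ->
  ((\int[leb]_(s in `[0, T]) running S w mu xi s)%:E <= value S x)%E.
Proof.
move=> dw sw tr T0; apply: ereal_sup_ubound; exists w, mu, xi, T; split => //.
have [ctrl [cxi _]] := infinite_horizon T dw sw tr.
by rewrite (payoffE S ctrl cxi)// lexx ltW.
Qed.

Lemma semigroup_ge (x : 'cV[R]_n) (V0 : 'cV[R]_n -> R) w mu xi (T : R) :
    disturbance w -> switching `[0, +oo[ mu ->
    trajectory S `[0, +oo[ w mu x xi -> 0 <= T ->
  ((\int[leb]_(s in `[0, T]) running S w mu xi s + V0 (xi T))%:E
    <= semigroup S T V0 x)%E.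
Proof.
move=> dw sw tr T0; apply: ereal_sup_ubound; exists w, mu, xi.
have [ctrl traj] := infinite_horizon T dw sw tr; have [cxi _] := traj.
split => //; last by rewrite (payoffE S ctrl cxi) ?lexx ?T0.
by apply: switchingS sw => //; exact: subset_itvl.
Qed.

Section Dissipative.
Variables cA cs cD : R.
Hypotheses (g0 : 0 < gain S) (hA : assumptionA1 S cA cs cD).

Lemma energy_nonincreasing (T l : R) w mu xi x (s t : R) :
    0 < l -> residual S cA cs cD l <= 0 ->
    controls T w mu -> trajectory S `[0, T] w mu x xi ->
    0 <= s -> s <= t -> t <= T ->
  l / 2 * enorm (xi t) ^+ 2 + \int[leb]_(u in `[s, t]) running S w mu xi u <=
  l / 2 * enorm (xi s) ^+ 2.
Proof.
move=> l0 ql ctrl traj s0 st tT.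
apply: le_trans (energy_dissipation g0 hA l0 ctrl traj s0 st tT) _.
rewrite gerDl mulr_le0_ge0//; first by rewrite pmulr_lle0.
by apply: Rintegral_ge0 => u _; exact: sqr_ge0.
Qed.

(** Every payoff is at most the initial energy, because the terminal energy is nonnegative. *)
Lemma value_le (l : R) x : 0 < l -> residual S cA cs cD l <= 0 ->
  (value S x <= (l / 2 * enorm x ^+ 2)%:E)%E.
Proof.
move=> l0 ql; apply: ge_ereal_sup => _ [w [mu [xi [T [dw sw tr T0 ->]]]]].
have [ctrl traj] := infinite_horizon T dw sw tr; have [cxi _] := traj.
have T0' := ltW T0.
rewrite (payoffE S ctrl cxi) ?lexx ?T0'// lee_fin.
have := energy_nonincreasing l0 ql ctrl traj (lexx 0) T0' (lexx T).
rewrite (trajectory_start T0' traj); apply: le_trans; rewrite lerDr.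
by rewrite mulr_ge0 ?sqr_ge0// divr_ge0// ltW.
Qed.

(** Here the terminal energy pays for [V0]. The main proof takes the vertex for [l], since [V0] may
    exceed [lambda_1 / 2 |x|^2]. *)
Lemma semigroup_le (l T : R) (V0 : 'cV[R]_n -> R) x :
    0 < l -> residual S cA cs cD l <= 0 -> 0 <= T ->
    (forall y, V0 y <= l / 2 * enorm y ^+ 2) ->
  (semigroup S T V0 x <= (l / 2 * enorm x ^+ 2)%:E)%E.
Proof.
move=> l0 ql T0 hV; apply: ge_ereal_sup => _ [w [mu [xi [dw sw traj ->]]]].
have ctrl := finite_horizon T0 dw sw; have [cxi _] := traj.
rewrite (payoffE S ctrl cxi) ?lexx ?T0// -EFinD lee_fin.
have := energy_nonincreasing l0 ql ctrl traj (lexx 0) T0 (lexx T).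
rewrite (trajectory_start T0 traj); apply: le_trans.
by rewrite addrC lerD2r.
Qed.

Lemma running_free_ge0 w mu xi t : w t = 0 -> 0 <= running S w mu xi t.
Proof.
move=> wt; rewrite /running wt enorm0 expr0n mulr0 subr0 mulr_ge0//.
have [_ _ _ hD _] := hA; have [h _] := hD (mu t) (xi t).
have [->|/h/ltW//] := eqVneq (xi t) 0.
by rewrite /qform mulmx0 mxE.
Qed.

Lemma free_trajectory (m0 : 'I_M) (x : 'cV[R]_n) :
  exists w mu xi, [/\ disturbance w, switching `[0, +oo[ mu,
    trajectory S `[0, +oo[ w mu x xi & forall t, 0 < t -> w t = 0].
Proof.
have ctrl0 : controls 0 (fun=> 0 : 'cV[R]_k) (fun=> m0).
  split.
  - by move=> j; exact: measurable_cst.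
  - apply: within_continuous_integrable.
    by apply: continuous_subspaceT => t; exact: cvg_cst.
  - move=> Y; have [Ym|Ym] := pselect (Y m0).
      by rewrite setIidl.
    by rewrite (_ : _ `&` _ = set0)// -subset0 => t [].
have tr0 : trajectory S `[0, 0] (fun=> 0 : 'cV[R]_k) (fun=> m0) x (fun=> x).
  split; first by apply: continuous_subspaceT => t; exact: cvg_cst.
  move=> t i; rewrite /= in_itv/= => t0.
  have -> : t = 0 by apply: le_anti; rewrite andbC.
  by rewrite set_itv1 Rintegral_set1 addr0.
have [w [mu [xi [dw sw tr _ w0]]]] := free_extension m0 (lexx 0) ctrl0 tr0.
by exists w, mu, xi.
Qed.

Lemma value_ge0 (m0 : 'I_M) x : (0 <= value S x)%E.
Proof.
have [w [mu [xi [dw sw tr w0]]]] := free_trajectory m0 x.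
apply: le_trans (value_ge dw sw tr ltr01).
have [ctrl [cxi _]] := infinite_horizon 1 dw sw tr.
(* The disturbance is known to vanish only at positive times, so the point 0 is removed. *)
rewrite lee_fin -Rintegral_itv_obnd_cbnd; last first.
  apply: (@integrableS _ _ R leb `[0, 1]) (integrable_running S ctrl cxi) => //.
  by apply: subset_itvr; rewrite bnd_simp.
apply: Rintegral_ge0 => t; rewrite /= in_itv/= => /andP[t0 _].
exact/running_free_ge0/w0.
Qed.

(** In use [v] is the value at [x] and [d] the optimality gap. The payoff on [t, T'] is at least
    [- d], of which at most [l / 2 |xi_T|^2] is earned after [T]; this gives the lower bound on
    [t, T]. *)
Lemma near_optimal_decay (T T' l L v d : R) w mu xi x :
    0 < T -> T <= T' -> 0 < l -> l < L ->
    residual S cA cs cD l <= 0 -> residual S cA cs cD L <= 0 ->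
    controls T' w mu -> trajectory S `[0, T'] w mu x xi ->
    (forall t, 0 <= t <= T ->
      \int[leb]_(u in `[0, t]) running S w mu xi u <= v) ->
    v - d <= \int[leb]_(u in `[0, T']) running S w mu xi u ->
  (L - l) / 2 * enorm (xi T) ^+ 2 <=
    d + expR (residual S cA cs cD L / L * T) * (L / 2 * enorm x ^+ 2).
Proof.
move=> T0 TT' l0 lL ql qL ctrl traj Jv vJ; have [cxi _] := traj.
have L0 := lt_trans l0 lL; have T'0 := le_trans (ltW T0) TT'.
have intr := integrable_running S ctrl cxi.
have cT : {within `[0, T], continuous xi}.
  by apply: continuous_subspaceW cxi; apply: subset_itvScc; rewrite bnd_simp.
rewrite -lerBlDl.
have -> : residual S cA cs cD L / L = - ((- residual S cA cs cD L / 2) / (L / 2)).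
  by field; rewrite gt_eqF.
rewrite -(trajectory_start T'0 traj).
(* Here [A = (L - l) / 2 |xi_T|^2 - d], [kap = - q(L) / 2] and [c = L / 2], whence the rate
   [- q(L) / L]. *)
apply: (@backward_gronwall R (fun t => enorm (xi t) ^+ 2)) => //.
- by rewrite divr_gt0.
- by rewrite divr_ge0// oppr_ge0.
- exact: within_continuous_enorm_sqr.
move=> t tT; have /andP[t0 tT0] := tT.
have := energy_dissipation g0 hA L0 ctrl traj t0 tT0 TT'.
have := energy_nonincreasing l0 ql ctrl traj (ltW T0) TT' (lexx T').
have := Jv t tT; move: vJ.
rewrite (@Rintegral_chasles _ _ 0 T T') ?(ltW T0)//.
rewrite (@Rintegral_chasles _ _ 0 t T) ?t0//; last first.
  exact: integrable_subitv intr.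
have : 0 <= l / 2 * enorm (xi T') ^+ 2.
  by rewrite mulr_ge0 ?sqr_ge0// divr_ge0// ltW.
move: (residual _ _ _ _ _) => q.
lra.
Qed.

End Dissipative.
End ValueFunction.

(** * The roots and the vertex of the parabola *)

Section Constants.
Context {R : realType} {M n k : nat}.
Variables (S : system R M n k) (cA cs cD mD lam : R).
Hypotheses (g0 : 0 < gain S) (hA1 : assumptionA1 S cA cs cD).

Let l1 := lambda1 (gain S) cA cs cD.
(** The vertex of the parabola [residual] in [l]. *)
Definition residual_argmin := gain S ^+ 2 * cA / cs ^+ 2.

(** [lambda1] is the smaller root. With [r] the square root in its formula, [r < cA] makes it
    positive and [0 < r] puts it left of the vertex. *)
Lemma lambda1_bounds : [/\ 0 < l1, l1 < residual_argmin & residual S cA cs cD l1 = 0].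
Proof.
have [[cA0 cs0 cD0] _ _ _ hlt] := hA1.
rewrite /l1 /lambda1 /residual_argmin; set r := Num.sqrt _.
have disc0 : 0 < cA ^+ 2 - cD * cs ^+ 2 / gain S ^+ 2 by rewrite subr_gt0.
have r0 : 0 < r by rewrite sqrtr_gt0.
have r2 : r ^+ 2 = cA ^+ 2 - cD * cs ^+ 2 / gain S ^+ 2 by rewrite sqr_sqrtr// ltW.
have rA : r < cA.
  rewrite -(@ltr_pXn2r _ 2) ?nnegrE ?ltW// r2 gtrDl oppr_lt0.
  by rewrite divr_gt0 ?mulr_gt0 ?exprn_gt0.
split.
- by rewrite divr_gt0 ?mulr_gt0 ?exprn_gt0// subr_gt0.
- by rewrite ltr_pM2r ?invr_gt0 ?exprn_gt0// ltr_pM2l ?exprn_gt0// gtrDl oppr_lt0.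
- rewrite /residual.
  transitivity (gain S ^+ 2 / cs ^+ 2 * (r ^+ 2 - cA ^+ 2) + cD).
    by field; rewrite !gt_eqF.
  by rewrite r2; field; rewrite !gt_eqF.
Qed.

(** The minimum is [cD - gain^2 cA^2 / cs^2], negative by the strict inequality in (A1). *)
Lemma residual_argmin_lt0 : residual S cA cs cD residual_argmin < 0.
Proof.
have [[cA0 cs0 cD0] _ _ _ hlt] := hA1; rewrite /residual /residual_argmin.
have -> : (gain S ^+ 2 * cA / cs ^+ 2) ^+ 2 * (cs ^+ 2 / gain S ^+ 2) -
    2 * cA * (gain S ^+ 2 * cA / cs ^+ 2) + cD =
    gain S ^+ 2 / cs ^+ 2 * (cD * cs ^+ 2 / gain S ^+ 2 - cA ^+ 2).
  by field; rewrite !gt_eqF.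
by rewrite pmulr_rlt0 ?subr_lt0// divr_gt0 ?exprn_gt0.
Qed.

(** The two bounds on [cost] give [mD <= cD], so [lambda2^2 <= cD gain^2 / cs^2 < residual_argmin^2]
    by (A1). Their comparison takes a nonzero vector, hence the factor |x|^2, which makes [x = 0]
    trivial. *)
Lemma lt_lambda2_le_argmin (x : 'cV[R]_n) : assumptionA2 S cA cs cD mD ->
  'I_M -> lam < lambda2 (gain S) cs mD ->
  lam * enorm x ^+ 2 <= residual_argmin * enorm x ^+ 2.
Proof.
move=> [mD0 hmD _] m lam2; have [[cA0 cs0 cD0] _ _ hD hlt] := hA1.
have [x0|x0] := eqVneq (enorm x ^+ 2) 0; first by rewrite x0 !mulr0.
have xp : 0 < enorm x ^+ 2 by rewrite lt_neqAle eq_sym x0 sqr_ge0.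
have mDcD : mD <= cD.
  rewrite -(ler_pM2r xp); apply: le_trans (hmD m x) _.
  by have [_] := hD m x.
rewrite ler_pM2r//; apply: ltW; apply: lt_trans lam2 _.
have L0 : 0 < residual_argmin by rewrite /residual_argmin divr_gt0 ?mulr_gt0 ?exprn_gt0.
rewrite /lambda2 -(@ltr_pXn2r _ 2) ?nnegrE ?sqrtr_ge0 ?(ltW L0)//.
rewrite sqr_sqrtr; last by rewrite divr_ge0 ?mulr_ge0 ?exprn_ge0 ?ltW.
apply: (@le_lt_trans _ _ (cD * gain S ^+ 2 / cs ^+ 2)).
  by rewrite ler_pM2r ?invr_gt0 ?exprn_gt0// ler_pM2r ?exprn_gt0.
rewrite -subr_lt0 /residual_argmin.
have -> : cD * gain S ^+ 2 / cs ^+ 2 - (gain S ^+ 2 * cA / cs ^+ 2) ^+ 2 =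
   (gain S ^+ 2 / cs ^+ 2) ^+ 2 * (cD * cs ^+ 2 / gain S ^+ 2 - cA ^+ 2).
  by field; rewrite !gt_eqF.
by rewrite pmulr_rlt0 ?subr_lt0// exprn_gt0// divr_gt0 ?exprn_gt0.
Qed.

End Constants.
Theorem theorem4p1 (R : realType) (M n k : nat) (S : system R M n k)
  (cA cs cD mD lam eps : R)
  (gain_gt0 : 0 < gain S)
  (cost_sym : forall m, (cost S m)^T = cost S m)
  (hA1 : assumptionA1 S cA cs cD)
  (hA2 : assumptionA2 S cA cs cD mD)
  (lam_ge : lambda1 (gain S) cA cs cD <= lam)
  (lam_lt : lam < lambda2 (gain S) cs mD)
  (eps_gt0 : 0 < eps)
  (hi : exists (t0 : R) (m : 'I_M) (Q : 'M[R]_n),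
      [/\ 0 < t0, riccati_flow S m t0 0 Q & loewner_le eps%:M Q])
  (hii : forall (m : 'I_M) (t : R) (P0 : 'M[R]_n),
      0 <= t -> loewner_itv eps%:M lam%:M P0 ->
      exists Q, riccati_flow S m t P0 Q /\ loewner_itv eps%:M lam%:M Q) :
  exists alpha K : R, [/\ 0 < alpha, 0 < K
    & forall (P0 : 'M[R]_n) (T : R) (x : 'cV[R]_n),
      loewner_itv eps%:M lam%:M P0 -> 0 < T ->
      let V := value S x in
      let ST := semigroup S T (fun y => 2^-1 * qform P0 y) x in
      [/\ V \is a fin_num, ST \is a fin_num
        & (V - ST <= (K * expR (- alpha * T) * enorm x ^+ 2)%:E)%E]].
Proof.
(* Hypothesis (i) supplies a mode, which drives the free continuations. *)
have [_ [m0 _]] := hi.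
have lamL y := lt_lambda2_le_argmin gain_gt0 hA1 y hA2 m0 lam_lt.
have := lambda1_bounds gain_gt0 hA1; have := residual_argmin_lt0 gain_gt0 hA1.
move: (lambda1 _ _ _ _) (residual_argmin _ _ _) lamL => l L lamL qL [l0 lL ql].
set q := residual S cA cs cD L in qL.
have L0 := lt_trans l0 lL.
have Ll0 : 0 < L - l by rewrite subr_gt0.
(* The rate and the factor [L / 2] come from Gronwall; the factor [l / (L - l)] converts the decay
   estimate for [(L - l) / 2 |xi_T|^2] into one for [l / 2 |xi_T|^2]. *)
exists (- q / L), (l * L / (2 * (L - l))); split.
- by rewrite divr_gt0// oppr_gt0.
- by rewrite divr_gt0 ?mulr_gt0.
move=> P0 T x [P0sym P0ge P0le] T0 V ST.
have V0ge y : 0 <= 2^-1 * qform P0 y.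
  have := P0ge y; rewrite qformB qform_scalar subr_ge0 => h.
  by rewrite mulr_ge0// (le_trans _ h)// mulr_ge0 ?sqr_ge0// ltW.
have V0le y : 2^-1 * qform P0 y <= L / 2 * enorm y ^+ 2.
  have := P0le y; rewrite qformB qform_scalar subr_ge0 => h.
  by have := lamL y; move: h; lra.
have Vge : (0 <= V)%E := value_ge0 hA1 m0 x.
have ql' : residual S cA cs cD l <= 0 by rewrite ql.
have qL' := ltW qL.
have Vle : (V <= (l / 2 * enorm x ^+ 2)%:E)%E := value_le gain_gt0 hA1 x l0 ql'.
have Vfin : V \is a fin_num.
  by rewrite ge0_fin_numE// (le_lt_trans Vle) ?ltry.
have STle := semigroup_le gain_gt0 hA1 x L0 qL' (ltW T0) V0le.
rewrite -/ST in STle.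
pose E := expR (q / L * T) * (L / 2 * enorm x ^+ 2).
(* The first [d] is the optimality gap; the rest bounds [l / 2 |xi_T|^2], the loss by truncation at
   [T]. *)
have key d : 0 < d -> (V <= ST + (d + l / (L - l) * (d + E))%:E)%E.
  move=> d0.
  have E0 : 0 <= E.
    by rewrite mulr_ge0 ?expR_ge0// mulr_ge0 ?sqr_ge0// divr_ge0// ltW.
  have [_ [w [mu [xi [T' [dw sw tr T'0 ->]]]]] vlt] := ub_ereal_sup_adherent d0 Vfin.
  have [ctrl traj] := infinite_horizon T' dw sw tr; have [cxi _] := traj.
  rewrite (payoffE S ctrl cxi) ?lexx ?(ltW T'0)// in vlt.
  rewrite -/(value S x) -/V -(fineK Vfin) -EFinB lte_fin in vlt.
  rewrite -(fineK Vfin).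
  have [TT'|T'T] := leP T T'.
    have Jv t : 0 <= t <= T ->
        \int[@lebesgue_measure R]_(u in `[0, t]) running S w mu xi u <= fine V.
      (* [value] admits only positive horizons; at [t = 0] the integral vanishes and [V >= 0]
         suffices. *)
      move=> /andP[]; rewrite le_eqVlt => /predU1P[<- _|t0 _].
        by rewrite set_itv1 Rintegral_set1 fine_ge0.
      rewrite -lee_fin (fineK Vfin); exact: value_ge tr t0.
    have := near_optimal_decay gain_gt0 hA1 T0 TT' l0 lL ql' qL' ctrl traj Jv
      (ltW vlt).
    rewrite -/q -/E => decay.
    have STge := semigroup_ge (fun y => 2^-1 * qform P0 y) dw sw tr (ltW T0).
    apply: (@le_trans _ _ ((\int[@lebesgue_measure R]_(u in `[0, T])
      running S w mu xi u + 2^-1 * qform P0 (xi T))%:E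
        + (d + l / (L - l) * (d + E))%:E)%E); last by rewrite leeD2r.
    rewrite -EFinD lee_fin.
    (* This bounds the payoff on [T, T'] by [l / 2 |xi_T|^2]. *)
    have tail := energy_nonincreasing gain_gt0 hA1 l0 ql' ctrl traj (ltW T0) TT'
      (lexx T').
    have : l / (L - l) * ((L - l) / 2 * enorm (xi T) ^+ 2) <= l / (L - l) * (d + E).
      by rewrite ler_wpM2l// divr_ge0// ltW.
    have -> : l / (L - l) * ((L - l) / 2 * enorm (xi T) ^+ 2) =
        l / 2 * enorm (xi T) ^+ 2.
      by field; rewrite gt_eqF.
    have := V0ge (xi T).
    have : 0 <= l / 2 * enorm (xi T') ^+ 2.
      by rewrite mulr_ge0 ?sqr_ge0// divr_ge0// ltW.
    rewrite (@Rintegral_chasles _ _ 0 T T') ?(ltW T0)// in vlt;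
      last exact: integrable_running.
    lra.
  have [w' [mu' [xi' [dw' sw' tr' agree w'0]]]] :=
    free_extension m0 (ltW T'0) ctrl traj.
  have STge := semigroup_ge (fun y => 2^-1 * qform P0 y) dw' sw' tr' (ltW T0).
  have [ctrl' [cxi' _]] := infinite_horizon T dw' sw' tr'.
  have intr' := integrable_running S ctrl' cxi'.
  apply: (@le_trans _ _ ((\int[@lebesgue_measure R]_(u in `[0, T])
      running S w' mu' xi' u + 2^-1 * qform P0 (xi' T))%:E
        + (d + l / (L - l) * (d + E))%:E)%E); last by rewrite leeD2r.
  rewrite -EFinD lee_fin.
  (* The cut leaves []T', T]] open at [T'], exactly where the extended disturbance is known to be
     zero. *)
  have := @Rintegral_itvB R _ (BLeft 0) (BRight T) T' intr'.
  rewrite !bnd_simp => /(_ (ltW T'0) (ltW T'T)) /eqP; rewrite subr_eq => /eqP ->.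
  have : 0 <= \int[@lebesgue_measure R]_(u in `]T', T]) running S w' mu' xi' u.
    apply: Rintegral_ge0 => t; rewrite /= in_itv/= => /andP[tT _].
    apply: running_free_ge0 hA1 _ _ _ _ (w'0 t tT).
  have -> : \int[@lebesgue_measure R]_(u in `[0, T']) running S w' mu' xi' u =
      \int[@lebesgue_measure R]_(u in `[0, T']) running S w mu xi u.
    apply: eq_Rintegral => t; rewrite inE/= in_itv/= => /andP[_ /agree[ew em ex]].
    by rewrite /running ew em ex.
  have := V0ge (xi' T).
  have : 0 <= l / (L - l) * (d + E).
    apply: mulr_ge0; last exact: addr_ge0 (ltW d0) E0.
    exact: divr_ge0 (ltW l0) (ltW Ll0).
  have arith (a b c1 c2 c3 c4 : R) : a - c1 < b -> 0 <= c2 -> 0 <= c3 -> 0 <= c4 ->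
      a <= c4 + b + c3 + (c1 + c2) by clear; lra.
  exact: arith vlt.
(* [STle] excludes [+oo]; [-oo] would force [V = -oo] through [key]. *)
have STfin : ST \is a fin_num.
  rewrite fin_numE; apply/andP; split; apply/eqP => STe.
    have := key 1 ltr01; rewrite STe addNye leeNy_eq => /eqP VN.
    by rewrite VN in Vfin.
  by rewrite STe in STle.
split => //; rewrite -(fineK Vfin) -(fineK STfin) -EFinB lee_fin.
rewrite lerBlDr addrC; apply/ler_addgt0Pr => e e0.
(* For this [d], the total error [d + l / (L - l) * d] equals [e]. *)
have d0 : 0 < e * ((L - l) / L) by rewrite mulr_gt0// divr_gt0.
have := key _ d0; rewrite -(fineK Vfin) -(fineK STfin) -EFinD lee_fin.
move=> /le_trans; apply; rewrite -addrA lerD2l le_eqVlt; apply/orP; left; apply/eqP.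
rewrite /E (_ : q / L * T = - (- q / L) * T); last by field; rewrite gt_eqF.
by field; rewrite !gt_eqF.
Qed.
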